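(* Let $n\ge 2$ and let $R=(r_{ij})$ be an $n\times n$ correlation matrix. Put $$r_2=\sqrt{\frac{\sum_{i\ne j}|r_{ij}|^2}{n(n-1)}}.$$ Let $\widehat{R}$ be the $n\times n$ matrix whose diagonal entries are all $1$ and whose off-diagonal entries are all $r_2$, and let $\overline{R}$ be the $n\times n$ matrix whose diagonal entries are all $1$ and whose off-diagonal entries are all $-r_2$. Then $$\det\overline{R}\le\det R\le\det\widehat{R}.$$
   Context: A correlation matrix is a real symmetric positive semidefinite matrix all of whose diagonal entries equal $1$. The sum $\sum_{i\neq j}$ runs over all ordered pairs $(i,j)$ with $1\le i,j\le n$ and $i\ne j$. *)

(* Defs.v *)
From mathcomp Require Import all_boot all_order all_algebra.
From mathcomp Require Import reals.

Set Implicit Arguments.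
Unset Strict Implicit.
Unset Printing Implicit Defensive.

Import Order.TTheory GRing.Theory Num.Theory.
Local Open Scope ring_scope.

Definition possemidef (R : realType) (n : nat) (A : 'M[R]_n) : Prop :=
  forall x : 'cV[R]_n, 0 <= (x^T *m A *m x) 0 0.

Definition correlation_matrix (R : realType) (n : nat) (A : 'M[R]_n) : Prop :=
  [/\ A \is symmetricmx, possemidef A & forall i, A i i = 1].

Definition offdiag_rms (R : realType) (n : nat) (A : 'M[R]_n) : R :=
  Num.sqrt ((\sum_(i < n) \sum_(j < n | i != j) `|A i j| ^+ 2)
            / (n%:R * (n%:R - 1))).

Definition equicorr_mx (R : realType) (n : nat) (r : R) : 'M[R]_n :=
  \matrix_(i < n, j < n) (if i == j then 1 else r).

(* Main.v *)
Require Import Defs.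
From mathcomp Require Import all_boot all_order all_algebra.
From mathcomp Require Import reals.
From mathcomp Require Import spectral sesquilinear.
From mathcomp Require Import normedtype derive realfun exp.
From mathcomp.real_closed Require Import complex.
From mathcomp Require Import ring lra.

(** The eigenvalues l_i >= 0 of A satisfy sum l_i = n and
    sum l_i^2 = n + n(n-1) r^2 with r = r_2, and the equicorrelation matrix
    with off-diagonal entry s = r or s = -r has the eigenvalue p = 1 - s with
    multiplicity n-1 and q = 1 + (n-1)s once, hence the same two moments.
    Let H be the quadratic agreeing with ln and its derivative at p and with
    ln at q.  Since (ln)''' > 0, ln - H has the sign of x - q.  By
    Cauchy-Schwarz |l_i - 1| <= (n-1) r, so every l_i is <= q when s = r and
    >= q when s = -r; summing ln l_i against H(l_i), whose sum depends only on
    the two moments, compares the products. *)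

Set Implicit Arguments.
Unset Strict Implicit.
Unset Printing Implicit Defensive.

Import Order.TTheory GRing.Theory Num.Theory.
Import numFieldNormedType.Exports.
Local Open Scope ring_scope.

(** * Determinant of equicorrelation matrices *)

(** Sylvester's identity: eliminating either off-diagonal block of [M] by a unitriangular factor
    leaves one of the two determinants. *)
Lemma det_subr_mulmx (F : comNzRingType) m n
    (B : 'M[F]_(m, n)) (C : 'M[F]_(n, m)) :
  \det (1%:M - B *m C) = \det (1%:M - C *m B).
Proof.
pose M := block_mx 1%:M B C 1%:M.
have MC : block_mx 1%:M 0 (- C) 1%:M *m M = block_mx 1%:M B 0 (1%:M - C *m B).
  by rewrite mulmx_block !mul1mx !mul0mx mulmx1 !addr0 addNr mulNmx addrC.
have MB : block_mx 1%:M (- B) 0 1%:M *m M = block_mx (1%:M - B *m C) 0 C 1%:M.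
  by rewrite mulmx_block !mul1mx !mul0mx mulmx1 !add0r subrr mulNmx.
move: (congr1 determinant MC) (congr1 determinant MB).
rewrite !det_mulmx !det_ublock !det_lblock !det1 !mul1r mulr1.
by move=> <- <-.
Qed.

Lemma det_equicorr_mx (R : realType) n (s : R) : (2 <= n)%N ->
  \det (equicorr_mx n s) = (1 - s) ^+ n.-1 * (1 + (n%:R - 1) * s).
Proof.
case: n => [|[|n]] // _; set x := 1 - s.
(* At s = 1 all rows coincide. Otherwise the matrix is x times a rank-one perturbation of the
   identity, and Sylvester's identity leaves a 1 x 1 determinant. *)
have [x0|x0] := eqVneq x 0.
  rewrite x0 expr0n mul0r; apply: (@determinant_alternate _ _ _ 0 1) => // j.
  rewrite !mxE (_ : s = 1) ?if_same //.
  by apply/eqP; rewrite eq_sym -subr_eq0 -/x x0.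
have -> : equicorr_mx n.+2 s =
    x *: (1%:M - (const_mx (- s / x) : 'cV_n.+2) *m (const_mx 1 : 'rV_n.+2)).
  apply/matrixP => i j; rewrite !mxE big_ord1 !mxE.
  by case: eqP => _ /=; rewrite /x; field.
rewrite detZ det_subr_mulmx det_mx11 !mxE.
under eq_bigr do rewrite !mxE mul1r.
rewrite sumr_const card_ord exprS -mulr_natl /= mulrAC mulrC /x.
by field.
Qed.

(** * Real spectrum of a positive semidefinite matrix *)

(** [A] is diagonalized over [R[i]]; the eigenvalues are real, so their real parts serve as [l]. *)
Lemma symmetric_psd_spectrum (R : realType) n (A : 'M[R]_n) :
  A \is symmetricmx -> possemidef A ->
  exists l : 'I_n -> R, [/\ forall i, 0 <= l i, \sum_i l i = \tr A,
    \sum_i l i ^+ 2 = \tr (A *m A) & \prod_i l i = \det A].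
Proof.
move=> Asym Apos; pose toC := real_complex R : {rmorphism R -> R[i]}.
pose Ac := map_mx toC A.
have Acreal : Ac \is a mxOver Num.real.
  by apply/mxOverP => i j; rewrite mxE complex_real.
have Acsym : Ac \is symmetricmx.
  move/is_hermitianmxP: Asym => /= Asym; apply/is_hermitianmxP => /=.
  rewrite {1}/Ac {1}Asym; apply/matrixP => i j.
  by rewrite !expr0 !scale1r !mxE.
have /orthomx_spectralP := symmetric_normalmx Acsym Acreal.
have := hermitian_spectral_diag_real (realsym_hermsym Acsym Acreal).
have := spectral_unit Ac; move: (spectralmx Ac) (spectral_diag Ac).
move=> P D Pu /mxOverP Dreal AcE.
pose l i : R := complex.Re (D 0 i).
have lE i : toC (l i) = D 0 i by apply: RRe_real.
have detP (x : R[i]) : \det (x%:M - Ac) = \prod_i (x - D 0 i).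
  have -> : x%:M - Ac = invmx P *m diag_mx (\row_i (x - D 0 i)) *m P.
    have -> : diag_mx (\row_i (x - D 0 i)) = x%:M - diag_mx D.
      by apply/matrixP => i j; rewrite !mxE; case: eqP => [->|]; rewrite ?subr0.
    rewrite AcE mulmxBr mulmxBl -scalemx1 -scalemxAr mulmx1.
    by rewrite -scalemxAl mulVmx.
  rewrite !det_mulmx mulrAC -det_mulmx mulVmx // det1 mul1r det_diag.
  by apply: eq_bigr => i _; rewrite mxE.
exists l; split.
(* [possemidef] tests real vectors only, so a real eigenvector is obtained from the vanishing of the
   characteristic polynomial at [l i]. *)
- move=> i; have /eqP/det0P[v v0 vA] : \det ((l i)%:M - A) = 0.
    apply: (fmorph_inj toC); rewrite rmorph0 -det_map_mx map_mxB map_scalar_mx.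
    by rewrite detP lE (bigD1 i) //= subrr mul0r.
  have {}vA : v *m A = l i *: v.
    by apply/eqP; rewrite eq_sym -subr_eq0 -mul_mx_scalar -mulmxBr vA.
  have := Apos v^T; rewrite trmxK vA -scalemxAl mxE.
  suff vv : 0 < (v *m v^T) 0 0 by rewrite pmulr_lge0.
  have [j vj] : exists j, v 0 j != 0 by apply/rV0Pn.
  rewrite mxE (bigD1 j) //= mxE ltr_pwDl //.
    by rewrite -expr2 exprn_even_gt0.
  by apply: sumr_ge0 => k _; rewrite mxE -expr2 sqr_ge0.
- apply: (fmorph_inj toC); rewrite -trace_map_mx -/Ac AcE mxtrace_mulC mulmxA.
  rewrite mulmxV // mul1mx mxtrace_diag raddf_sum.
  by apply: eq_bigr => i _; exact: lE.
- apply: (fmorph_inj toC); rewrite -trace_map_mx map_mxM -/Ac AcE.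
  rewrite !mulmxA mulmxK // mxtrace_mulC !mulmxA mulmxV // mul1mx.
  rewrite mulmx_diag mxtrace_diag raddf_sum.
  by apply: eq_bigr => i _; rewrite mxE -lE -expr2; apply: rmorphXn.
- apply: (fmorph_inj toC); rewrite -det_map_mx -/Ac AcE.
  rewrite !det_mulmx mulrAC -det_mulmx mulVmx // det1 mul1r det_diag rmorph_prod.
  by apply: eq_bigr => i _; exact: lE.
Qed.

(** * Monotonicity estimates for the logarithm *)

Lemma is_derive_ge0_le (R : realType) (f df : R -> R) (a b : R) : a <= b ->
  (forall x, a <= x <= b -> is_derive x 1 f (df x)) ->
  (forall x, a <= x <= b -> 0 <= df x) -> f a <= f b.
Proof.
move=> ab fdf df0.
have [||c cab E] := @MVT_segment R f df a b ab.
- move=> x; rewrite in_itv /= => /andP[ax xb]; apply: fdf.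
  by rewrite !ltW.
- apply: derivable_within_continuous => x; rewrite in_itv /= => xab.
  by have [] := fdf x xab.
rewrite -subr_ge0 E mulr_ge0 ?subr_ge0 //; apply: df0.
by move: cab; rewrite in_itv.
Qed.

Lemma ln_le_subr1 (R : realType) (x : R) : 0 < x -> ln x <= x - 1.
Proof.
by move=> x0; have := @le_ln1Dx R (x - 1); rewrite subrKC; apply; lra.
Qed.

(** The derivative is (t - 1)^2 / t. Since the function vanishes at 1, this compares ln t - (t - 1)
    with -(t - 1)^2 / 2 on each side of 1. *)
Lemma ln_taylor2_remainder_le (R : realType) (x y : R) : 0 < x -> x <= y ->
  ln x - (x - 1) + (x - 1) ^+ 2 / 2 <= ln y - (y - 1) + (y - 1) ^+ 2 / 2.
Proof.
move=> x0 xy; pose f t : R := ln t - (t - 1) + (t - 1) ^+ 2 / 2.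
pose df t : R := (t - 1) ^+ 2 / t.
have fdf t : x <= t <= y -> is_derive t 1 f (df t).
  move=> /andP[xt _]; have t0 : 0 < t by lra.
  have ? := is_derive1_ln t0.
  by apply: is_derive_eq; rewrite /df /GRing.scale /=; field; lra.
apply: (is_derive_ge0_le xy fdf) => t /andP[xt _].
by rewrite divr_ge0 ?sqr_ge0 //; lra.
Qed.

(** The function vanishes at 1, so it has the sign of t - 1; it is a factor of the derivative of the
    divided difference below. *)
Lemma sqr_sub_xlnx_le (R : realType) (x y : R) : 0 < x -> x <= y ->
  x ^+ 2 - 1 - 2 * x * ln x <= y ^+ 2 - 1 - 2 * y * ln y.
Proof.
move=> x0 xy; pose f t : R := t ^+ 2 - 1 - 2 * t * ln t.
pose df t : R := 2 * (t - 1 - ln t).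
have fdf t : x <= t <= y -> is_derive t 1 f (df t).
  move=> /andP[xt _]; have t0 : 0 < t by lra.
  have ? := is_derive1_ln t0.
  by apply: is_derive_eq; rewrite /df /GRing.scale /=; field; lra.
apply: (is_derive_ge0_le xy fdf) => t /andP[xt _].
by rewrite /df; have := @ln_le_subr1 _ t; lra.
Qed.

(** The two factors in the numerator of [df] change sign together at 1. The interval must avoid 1,
    where the quotient takes the default value 0. *)
Lemma ln_divided_difference_le (R : realType) (x y : R) : 0 < x -> x <= y ->
  ~~ (x <= 1 <= y) ->
  (ln x - (x - 1)) / (x - 1) ^+ 2 <= (ln y - (y - 1)) / (y - 1) ^+ 2.
Proof.
move=> x0 xy; rewrite negb_and -!ltNge => side.
pose f t : R := (ln t - (t - 1)) / (t - 1) ^+ 2.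
pose df t : R := (t ^+ 2 - 1 - 2 * t * ln t) * (t - 1) / (t * (t - 1) ^+ 4).
have fdf t : x <= t <= y -> is_derive t 1 f (df t).
  move=> /andP[xt ty]; have t0 : 0 < t by lra.
  have t1 : t - 1 != 0 by case/orP: side => ?; rewrite subr_eq0; lra.
  have ? := is_derive1_ln t0.
  have dsq : is_derive t 1 (fun t : R => (t - 1) ^+ 2) (2 * (t - 1)).
    by apply: is_derive_eq; rewrite /GRing.scale /=; ring.
  have ? := is_deriveV (x := t) (v := 1) (f := fun t : R => (t - 1) ^+ 2)
    (expf_neq0 2 t1).
  apply: is_derive_eq.
  by rewrite /df /GRing.scale /=; field; rewrite t1; lra.
apply: (is_derive_ge0_le xy fdf) => t /andP[xt ty]; have t0 : 0 < t by lra.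
rewrite /df; apply: divr_ge0; last by rewrite mulr_ge0 ?exprn_even_ge0 ?ltW.
have [t1|t1] := leP 1 t.
  have := sqr_sub_xlnx_le ltr01 t1; rewrite ln1 => h.
  by apply: mulr_ge0; lra.
have := sqr_sub_xlnx_le t0 (ltW t1); rewrite ln1 => h.
by apply: mulr_le0; lra.
Qed.

(** Cross-multiplied monotonicity of the second divided difference
    (ln x - (x - 1)) / (x - 1)^2 of [ln] at the nodes 1, 1, x.  Its value at
    x = 1 is -1/2, which separates the cases x < 1 and x > 1. *)
Lemma ln_tangent_gap_cross_le (R : realType) (x y : R) : 0 < x -> x <= y ->
  (ln x - (x - 1)) * (y - 1) ^+ 2 <= (ln y - (y - 1)) * (x - 1) ^+ 2.
Proof.
move=> x0 xy.
have [/andP[x1 y1]|side] := boolP (x <= 1 <= y).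
  have := ln_taylor2_remainder_le x0 x1.
  have := ln_taylor2_remainder_le ltr01 y1.
  rewrite ln1 !subrr expr0n /= mul0r addr0 => hy hx.
  have := sqr_ge0 (x - 1); have := sqr_ge0 (y - 1).
  set X := (x - 1) ^+ 2 in hx *; set Y := (y - 1) ^+ 2 in hy *; nra.
have := ln_divided_difference_le x0 xy side.
have x1 : 0 < (x - 1) ^+ 2.
  by rewrite exprn_even_gt0 //= subr_eq0; lra.
have y1 : 0 < (y - 1) ^+ 2.
  by rewrite exprn_even_gt0 //= subr_eq0; lra.
by rewrite ler_pdivrMr // mulrAC ler_pdivlMr.
Qed.

(** * Comparing products through two moments *)

Lemma ln_prod (R : realType) (I : finType) (u : I -> R) :
  (forall i, 0 < u i) -> ln (\prod_i u i) = \sum_i ln (u i).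
Proof.
move=> u0.
suff [] : 0 < \prod_i u i /\ ln (\prod_i u i) = \sum_i ln (u i) by [].
apply: (big_ind2 (fun x y => 0 < x /\ ln x = y)) =>
  [|x a y b [x0 <-] [y0 <-]|//].
  by rewrite ln1.
by rewrite mulr_gt0 // lnM.
Qed.

(** The case p = 1, q = v: summing [ln_tangent_gap_cross_le] over the family and inserting the
    moments leaves a common factor (v - 1)^2 to cancel. *)
Lemma prod_cmp_of_moments_at1 (R : realType) (I : finType) (u : I -> R) (v : R) :
    (forall i, 0 < u i) -> 0 < v ->
    \sum_i (u i - 1) = v - 1 -> \sum_i (u i - 1) ^+ 2 = (v - 1) ^+ 2 ->
  ((forall i, u i <= v) -> \prod_i u i <= v) /\
  ((forall i, v <= u i) -> v <= \prod_i u i).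
Proof.
move=> u0 v0 m1 m2; have P0 : 0 < \prod_i u i by apply: prodr_gt0.
(* Here that factor vanishes, but the second moment forces every [u i] to be 1. *)
have [v1|v1] := eqVneq v 1.
  rewrite v1 subrr expr0n /= in m2.
  have u1 i : u i = 1.
    have /eqP := m2; rewrite psumr_eq0 => [/allP/(_ i)|j _]; last exact: sqr_ge0.
    by rewrite mem_index_enum sqrf_eq0 subr_eq0 => /(_ isT)/eqP.
  by rewrite big1 // v1.
have vsq : 0 < (v - 1) ^+ 2 by rewrite exprn_even_gt0 //= subr_eq0.
have sumL : \sum_i (ln (u i) - (u i - 1)) * (v - 1) ^+ 2 =
    (ln (\prod_i u i) - (v - 1)) * (v - 1) ^+ 2.
  by rewrite -mulr_suml sumrB m1 ln_prod.
have sumR : \sum_i (ln v - (v - 1)) * (u i - 1) ^+ 2 =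
    (ln v - (v - 1)) * (v - 1) ^+ 2 by rewrite -mulr_sumr m2.
split=> uv; rewrite -ler_ln // -(lerD2r (- (v - 1))) -(ler_pM2r vsq).
  by rewrite -sumL -sumR; apply: ler_sum => i _; apply: ln_tangent_gap_cross_le.
by rewrite -sumL -sumR; apply: ler_sum => i _; apply: ln_tangent_gap_cross_le.
Qed.

(** Dividing everything by p reduces to the node 1. *)
Lemma prod_cmp_of_moments (R : realType) n (l : 'I_n -> R) (p q : R) :
    (0 < n)%N -> (forall i, 0 < l i) -> 0 < p -> 0 < q ->
    \sum_i (l i - p) = q - p -> \sum_i (l i - p) ^+ 2 = (q - p) ^+ 2 ->
  ((forall i, l i <= q) -> \prod_i l i <= p ^+ n.-1 * q) /\
  ((forall i, q <= l i) -> p ^+ n.-1 * q <= \prod_i l i).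
Proof.
move=> n0 l0 p0 q0 m1 m2; have pn0 : p != 0 by rewrite gt_eqF.
have sc x : x / p - 1 = (x - p) / p by field.
have [] := @prod_cmp_of_moments_at1 R 'I_n (fun i => l i / p) (q / p).
- by move=> i; rewrite divr_gt0.
- by rewrite divr_gt0.
- by under eq_bigr do rewrite sc; rewrite -mulr_suml m1 sc.
- by under eq_bigr do rewrite sc expr_div_n; rewrite -mulr_suml m2 sc expr_div_n.
have -> : \prod_i (l i / p) = (\prod_i l i) / p ^+ n.
  by rewrite big_split /= prodr_const card_ord exprVn.
have pq : q / p = p ^+ n.-1 * q / p ^+ n.
  by rewrite -{2}(prednK n0) exprS; field; rewrite expf_neq0.
rewrite pq => le ge; have pn : 0 < (p ^+ n)^-1 by rewrite invr_gt0 exprn_gt0.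
split=> lq; rewrite -(ler_pM2r pn); [apply: le | apply: ge] => i;
  by rewrite -pq ler_pM2r ?invr_gt0.
Qed.

(** * Nonnegative families of mean 1 with prescribed second moment *)

Section UnitMeanFamily.
Variables (R : realType) (n : nat) (l : 'I_n -> R) (r : R).
Hypotheses (n2 : (2 <= n)%N) (r0 : 0 <= r) (l0 : forall i, 0 <= l i).
Hypotheses (m1 : \sum_i l i = n%:R)
  (m2 : \sum_i l i ^+ 2 = n%:R + n%:R * (n%:R - 1) * r ^+ 2).

Let n1 : 0 < n%:R - 1 :> R. Proof. by rewrite subr_gt0 ltr1n. Qed.

Let N0 : 0 < n%:R * (n%:R - 1) :> R.
Proof. by rewrite mulr_gt0 // ltr0n ltnW. Qed.

Let sumB c : \sum_i (l i - c) = n%:R * (1 - c).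
Proof. by rewrite sumrB m1 sumr_const card_ord -mulr_natl; ring. Qed.

Let sumsqB c :
  \sum_i (l i - c) ^+ 2 = n%:R * (n%:R - 1) * r ^+ 2 + n%:R * (1 - c) ^+ 2.
Proof.
have E i : (l i - c) ^+ 2 = l i ^+ 2 - (2 * c) * l i + c ^+ 2 by ring.
rewrite (eq_bigr _ (fun i _ => E i)) big_split sumrB /= m2 -mulr_sumr m1.
rewrite sumr_const card_ord -mulr_natl; ring.
Qed.

Lemma dist_mean_le i : `|l i - 1| <= (n%:R - 1) * r.
Proof.
(* c = 1 - a is the sharpest choice in (l i - c)^2 <= sum_j (l j - c)^2. *)
pose a := (l i - 1) / (n%:R - 1).
have la : l i - 1 = (n%:R - 1) * a by rewrite /a mulrC divfK ?gt_eqF.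
rewrite la normrM (gtr0_norm n1) ler_pM2l // -(ler_pXn2r (ltn0Sn 1)) ?nnegrE //.
rewrite real_normK ?num_real //.
have : (l i - (1 - a)) ^+ 2 <= \sum_j (l j - (1 - a)) ^+ 2.
  by rewrite (bigD1 i) //= lerDl sumr_ge0 // => j _; apply: sqr_ge0.
rewrite sumsqB (_ : l i - (1 - a) = n%:R * a); last first.
  by rewrite opprB addrCA la; ring.
(* [h] reads (n a)^2 <= n(n-1) r^2 + n a^2, that is n(n-1) a^2 <= n(n-1) r^2. *)
by move=> h; rewrite -(ler_pM2l N0); nra.
Qed.

Lemma prod_ge_unit_mean :
  (1 + r) ^+ n.-1 * (1 - (n%:R - 1) * r) <= \prod_i l i.
Proof.
have p0 : 0 < 1 + r by rewrite ltr_pwDl.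
(* If q <= 0 the bound is nonpositive; if q > 0, then [lq] makes every [l i] positive, as logarithms
   require. *)
have [q0|q0] := leP (1 - (n%:R - 1) * r) 0.
  apply: (@le_trans _ _ 0); rewrite ?prodr_ge0 //.
  by rewrite mulr_ge0_le0 // exprn_ge0 ?ltW.
have lq i : 1 - (n%:R - 1) * r <= l i.
  by have := dist_mean_le i; rewrite ler_norml => /andP[? _]; lra.
apply: (prod_cmp_of_moments _ _ _ _ _ _).2 => //.
- by apply: leq_trans n2.
- by move=> i; apply: lt_le_trans (lq i).
- by rewrite sumB; ring.
- by rewrite sumsqB; ring.
Qed.

Lemma prod_le_unit_mean :
  \prod_i l i <= (1 - r) ^+ n.-1 * (1 + (n%:R - 1) * r).
Proof.
have q0 : 0 < 1 + (n%:R - 1) * r by rewrite ltr_pwDl // mulr_ge0 // ltW.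
(* Each [l i] is at most the total n; summing gives n + n(n-1) r^2 <= n^2, hence r <= 1. *)
have sqle i : l i ^+ 2 <= l i * n%:R.
  by rewrite expr2 ler_wpM2l // -m1 (bigD1 i) //= lerDl sumr_ge0.
have r1 : r <= 1.
  rewrite -(ler_pXn2r (ltn0Sn 1)) ?nnegrE // -(ler_pM2l N0).
  have : \sum_i l i ^+ 2 <= \sum_i l i * n%:R by apply: ler_sum.
  by rewrite m2 -mulr_suml m1; lra.
(* A zero entry kills the product, while the bound is nonnegative. *)
have [/forallP lpos|/forallPn] := boolP [forall i, 0 < l i]; last first.
  case=> i; rewrite -leNgt => li0.
  rewrite (bigD1 i) //= (_ : l i = 0); last by apply/eqP; rewrite eq_le li0 l0.
  by rewrite mul0r mulr_ge0 ?exprn_ge0 ?subr_ge0 // ltW.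
have {}r1 : r < 1.
  rewrite -(ltr_pXn2r (ltn0Sn 1)) ?nnegrE // -(ltr_pM2l N0).
  (* The positive entry at [i1] makes [l i0] < n strict, which yields r < 1 and so p = 1 - r > 0. *)
  pose i0 := Ordinal (ltnW n2); pose i1 := Ordinal n2.
  have : \sum_i l i ^+ 2 < \sum_i l i * n%:R.
    rewrite (bigD1 i0) //= [ltRHS](bigD1 i0) //= ltr_leD // ?ler_sum //.
    rewrite expr2 ltr_pM2l // -m1 (bigD1 i0) //= ltrDl (bigD1 i1) //=.
    by rewrite ltr_pwDl // sumr_ge0.
  by rewrite m2 -mulr_suml m1; lra.
have lq i : l i <= 1 + (n%:R - 1) * r.
  by have := dist_mean_le i; rewrite ler_norml => /andP[_ ?]; lra.
apply: (prod_cmp_of_moments _ _ _ _ _ _).1 => //.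
- by apply: leq_trans n2.
- by lra.
- by rewrite sumB; ring.
- by rewrite sumsqB; ring.
Qed.

End UnitMeanFamily.

(** * Application to correlation matrices *)

Theorem corollary1p2 (R : realType) (n : nat) (hn : (2 <= n)%N)
    (A : 'M[R]_n) (hA : correlation_matrix A) :
  \det (equicorr_mx n (- offdiag_rms A)) <= \det A /\
  \det A <= \det (equicorr_mx n (offdiag_rms A)).
Proof.
have [Asym Apos Adiag] := hA.
have [l [l0 m1 m2 <-]] := symmetric_psd_spectrum Asym Apos.
have n2R : 2 <= n%:R :> R by rewrite ler_nat.
have N0 : 0 < n%:R * (n%:R - 1) :> R by apply: mulr_gt0; lra.
have T0 : 0 <= \sum_(i < n) \sum_(j < n | i != j) `|A i j| ^+ 2.
  by apply: sumr_ge0 => i _; apply: sumr_ge0 => j _; rewrite exprn_ge0.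
rewrite !det_equicorr_mx // opprK mulrN.
set r := offdiag_rms A.
have r0 : 0 <= r by apply: sqrtr_ge0.
have {}m1 : \sum_i l i = n%:R.
  rewrite m1 /mxtrace (eq_bigr (fun=> 1)) => [|i _]; last exact: Adiag.
  by rewrite sumr_const card_ord.
(* By symmetry the trace of A^2 is the sum of all squared entries: the diagonal gives n, the rest
   n(n-1) r^2. *)
have {}m2 : \sum_i l i ^+ 2 = n%:R + n%:R * (n%:R - 1) * r ^+ 2.
  rewrite sqr_sqrtr; last by rewrite divr_ge0 // ltW.
  rewrite [_ * (_ / _)]mulrC divfK ?gt_eqF //.
  have AT i j : A j i = A i j.
    move/is_hermitianmxP: Asym => /matrixP/(_ j i).
    by rewrite expr0 scale1r !mxE.
  have -> : n%:R = \sum_(i < n) 1 :> R by rewrite sumr_const card_ord.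
  rewrite m2 /mxtrace -big_split /=.
  apply: eq_bigr => i _; rewrite mxE (bigD1 i) //= !Adiag mulr1; congr (_ + _).
  apply: eq_big => [j|j _]; first by rewrite eq_sym.
  by rewrite AT real_normK ?num_real ?expr2.
by split; [apply: prod_ge_unit_mean | apply: prod_le_unit_mean].
Qed.
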